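(* Let $K=K(x,\theta;y,\phi)$ be the bi-symmetric formal superfunction $$K:=\prod_{i,j\ge1}\frac1{1-x_iy_j-\theta_i\phi_j}.$$ Then $$K=\sum_{\Lambda}z_\Lambda^{-1}\,\overleftarrow{p_\Lambda(x,\theta)}\;p_\Lambda(y,\phi),$$ the sum running over all superpartitions $\Lambda$.
   Context: $x_i,y_j$ ($i,j\ge1$) are commuting variables; $\theta_i,\phi_j$ are mutually anticommuting variables (each squares to zero, any two of them anticommute), commuting with the $x_i,y_j$. A superpartition of $(n|m)$ is $\Lambda=(\Lambda^a;\Lambda^s)=(\Lambda_1,\dots,\Lambda_m;\Lambda_{m+1},\Lambda_{m+2},\dots)$ with nonnegative integer entries, $\Lambda_1>\dots>\Lambda_m\ge 0$, $\Lambda_{m+1}\ge\Lambda_{m+2}\ge\dots\ge0$ (finitely many nonzero; trailing zeros of $\Lambda^s$ ignored) and $\sum_i\Lambda_i=n$; $\ell(\Lambda)=m+\#\{\text{nonzero parts of }\Lambda^s\}$. $p_n(x)=\sum_i x_i^n$ ($n\ge1$), $\tilde p_n(x,\theta)=\sum_i\theta_ix_i^n$ ($n\ge0$), $p_\Lambda=\tilde p_{\Lambda_1}\cdots\tilde p_{\Lambda_m}\,p_{\Lambda_{m+1}}\cdots p_{\Lambda_{\ell(\Lambda)}}$. For $f(x,\theta)$ homogeneous of degree $m$ in $\theta$, $\overleftarrow{f}=(-1)^{m(m-1)/2}f$ (reversal of the order of the $\theta$'s). $z_\Lambda=\prod_{k\ge1}k^{n_k}n_k!$ where $n_k$ is the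 number of parts of $\Lambda^s$ equal to $k$. *)

(* Defs.v *)
From HB Require Import structures.
From mathcomp Require Import all_boot all_order all_algebra.
From mathcomp Require Import finmap multiset.
From mathcomp Require Import boolp classical_sets functions.

Set Implicit Arguments.
Unset Strict Implicit.
Unset Printing Implicit Defensive.

Import Order.TTheory GRing.Theory.
Local Open Scope fset_scope.
Local Open Scope mset_scope.
Local Open Scope ring_scope.

(* Formal power series over F in commuting variables indexed by V and mutually
   anticommuting variables indexed by W, both possibly infinite.  A monomial is
   a pair (A, S) with A the multiset of its commuting variables and S the set of
   its anticommuting ones; it stands for the product of the variables of A times
   the product of the variables of S taken in increasing order. *)
Section Monomials.
Context (V : choiceType) (d : Order.disp_t) (W : orderType d).

Definition smonom : Type := ({mset V} * {fset W})%type.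
HB.instance Definition _ := Choice.on smonom.

Implicit Types (a b c m : smonom) (S T U : {fset W}).

Definition smone : smonom := (mset0, fset0).
Definition smadd a b : smonom := (a.1 `+` b.1, (a.2 `|` b.2)%fset)%mset.
Definition smdiff m a : smonom := (m.1 `\` a.1, (m.2 `\` a.2)%fset)%mset.
Definition smle a m : bool := (a.1 `<=` m.1)%mset && (a.2 `<=` m.2)%fset.
Definition smdeg m : nat := (size m.1 + #|` m.2|)%N.

Definition msubsets (A : {mset V}) : {fset {mset V}} :=
  [fset seq_mset (mask (val t) A) | t in {: (size A).-tuple bool}]%fset.

Definition smdivisors m : seq smonom :=
  [seq (A, T) | A <- msubsets m.1, T <- fpowerset m.2].

(* For disjoint S and T, the product of the monomials of S and of T (in this
   order) is (-1)^(inversions S T) times the monomial of the union. *)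
Definition inversions S T : nat := \sum_(s <- S) \sum_(t <- T) (t < s)%O.

Lemma mem_msubsets (A B : {mset V}) : (B \in msubsets A) = (B `<=` A)%mset.
Proof.
apply/imfsetP/msubsetP => /= [[t _ ->] x|le_BA].
  rewrite mset_seqE -[A x]count_mem_mset.
  by apply: leq_count_subseq; exact: mask_subseq.
have /count_subseqP[s /subseqP[t st ->] Bs] :
    forall x, (count_mem x B <= count_mem x A)%N.
  by move=> x; rewrite !count_mem_mset.
exists (Tuple (introT eqP st)) => //=.
by rewrite -[LHS]seq_mset_id; apply/eq_seq_msetP.
Qed.

Lemma mem_smdivisors m a : (a \in smdivisors m) = smle a m.
Proof.
apply/allpairsP/andP => [[[A S] /= [Am Sm ->]]|[Am Sm]] /=.
  by rewrite -mem_msubsets Am -fpowersetE Sm.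
by exists a; rewrite mem_msubsets fpowersetE Am Sm; split=> //; case: (a).
Qed.

Lemma smdivisors_uniq m : uniq (smdivisors m).
Proof. by apply: allpairs_uniq; rewrite ?fset_uniq // => -[A S] [B T] _ _ [-> ->]. Qed.

Lemma smleP a m :
  reflect ((a.1 `<=` m.1)%mset /\ (a.2 `<=` m.2)%fset) (smle a m).
Proof. exact: andP. Qed.

Lemma smdiff_split m c b : smle c m -> smle b (smdiff m c) ->
  [/\ smle (smadd c b) m, smle c (smadd c b), smdiff (smadd c b) c = b
    & smdiff m (smadd c b) = smdiff (smdiff m c) b].
Proof.
move=> /smleP[c1 c2] /smleP[/= b1 b2]; split.
- apply/smleP; split => /=; last first.
    rewrite fsubUset c2 (fsubset_trans b2) // fsubsetDl //.
  by rewrite -(msetBDKC c1) msetDS.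
- by apply/smleP; split; rewrite /= ?fsubsetUl //; apply/msubsetP => x;
    rewrite msetE2 leq_addr.
- case: b b1 b2 => b1 b2 /= _ /fsubsetP sb; congr pair; rewrite /= ?msetDKB //.
  apply/fsetP => x; rewrite !inE.
  by have := sb x; rewrite !inE; case: (x \in b2) => [/(_ isT)/andP[->]|_];
    rewrite ?orbT // orbF andNb.
- by rewrite /smdiff /= msetBDA fsetDDl.
Qed.

Lemma smdiff_le m a c : smle a m -> smle c a ->
  [/\ smle c m, smle (smdiff a c) (smdiff m c) & smadd c (smdiff a c) = a].
Proof.
move=> /smleP[a1 a2] /smleP[c1 c2]; split.
- by apply/smleP; rewrite (msubset_trans c1) // (fsubset_trans c2).
- by apply/smleP; rewrite /= msetSB // fsetSD.
- case: a {a1 a2} c1 c2 => a1 a2 /= c1 c2; congr pair; rewrite /= ?msetBDKC //.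
  apply/fsetP => x; rewrite !inE; have /fsubsetP/(_ x) := c2.
  by case: (x \in c.2) => //= ->.
Qed.

Lemma inversionsUl S T U : [disjoint S & T]%fset ->
  inversions (S `|` T)%fset U = (inversions S U + inversions T U)%N.
Proof.
move=> dST; rewrite /inversions -big_cat; apply: perm_big.
apply: uniq_perm; rewrite ?fset_uniq // ?cat_uniq ?fset_uniq //=.
  rewrite andbT; apply/hasPn => x xT; apply/negP => xS.
  by have /fdisjointP/(_ x xS)/negP := dST.
by move=> x; rewrite mem_cat inE.
Qed.

Lemma inversionsUr S T U : [disjoint T & U]%fset ->
  inversions S (T `|` U)%fset = (inversions S T + inversions S U)%N.
Proof.
move=> dTU; rewrite /inversions -big_split; apply: eq_bigr => s _ /=.
rewrite -big_cat; apply: perm_big.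
apply: uniq_perm; rewrite ?fset_uniq // ?cat_uniq ?fset_uniq //=.
  rewrite andbT; apply/hasPn => x xT; apply/negP => xS.
  by have /fdisjointP/(_ x xS)/negP := dTU.
by move=> x; rewrite mem_cat inE.
Qed.

Lemma size_msetD (A B : {mset V}) : size (A `+` B)%mset = (size A + size B)%N.
Proof.
rewrite -size_cat; apply: perm_size; apply/allP => x _ /=.
by rewrite count_cat !count_mem_mset msetE2.
Qed.

Lemma smdeg_diff m a : smle a m -> smdeg m = (smdeg a + smdeg (smdiff m a))%N.
Proof.
move=> /smleP[a1 a2]; rewrite /smdeg /= addnACA -size_msetD msetBDKC //.
by rewrite -(cardfsID a.2 m.2) (fsetIidPr a2).
Qed.

Lemma smdeg_eq0 m : (smdeg m == 0)%N = (m == smone).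
Proof.
by case: m => A S; rewrite /smdeg addn_eq0 size_mset_eq0 cardfs_eq0 /smone xpair_eqE.
Qed.

End Monomials.

Section SuperSeries.
Context (F : fieldType) (V : choiceType) (d : Order.disp_t) (W : orderType d).

(* f m is the coefficient of the monomial m in f. *)
Definition superseries : Type := smonom V W -> F.
HB.instance Definition _ := GRing.Zmodule.copy superseries (smonom V W -> F^o).
HB.instance Definition _ := GRing.Lmodule.copy superseries (smonom V W -> F^o).

Implicit Types (f g h : superseries) (m a b c : smonom V W).

(* smono and ssmul are sealed to keep unification from unfolding them. *)
Fact smono_key : unit. Proof. by []. Qed.
Definition smono : smonom V W -> superseries :=
  locked_with smono_key (fun m m' => (m' == m)%:R).

Lemma smonoE m m' : smono m m' = (m' == m)%:R.
Proof. by rewrite /smono unlock. Qed.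

Fact ssmul_key : unit. Proof. by []. Qed.
Definition ssmul : superseries -> superseries -> superseries :=
  locked_with ssmul_key (fun f g m =>
    \sum_(a <- smdivisors m)
       (-1) ^+ inversions a.2 (smdiff m a).2 * f a * g (smdiff m a)).

Lemma ssmulE f g m : ssmul f g m = \sum_(a <- smdivisors m)
  (-1) ^+ inversions a.2 (smdiff m a).2 * f a * g (smdiff m a).
Proof. by rewrite /ssmul unlock. Qed.

Lemma ssD f g m : (f + g) m = f m + g m. Proof. by []. Qed.
Lemma ssN f m : (- f) m = - f m. Proof. by []. Qed.
Lemma ssZ k f m : (k *: f) m = k * f m. Proof. by []. Qed.
Lemma ss0 m : (0 : superseries) m = 0. Proof. by []. Qed.
Lemma ss_sum (I : Type) (r : seq I) (P : pred I) (u : I -> superseries) m :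
  (\sum_(i <- r | P i) u i) m = \sum_(i <- r | P i) u i m.
Proof. exact: (big_morph (fun f => f m) (fun f g => ssD f g m) (ss0 m)). Qed.

Lemma big_smdivisors m (G : smonom V W -> smonom V W -> F) :
  \sum_(c <- smdivisors m) \sum_(b <- smdivisors (smdiff m c)) G c b =
  \sum_(a <- smdivisors m) \sum_(c <- smdivisors a) G c (smdiff a c).
Proof.
pose G' p := G p.1 p.2.
transitivity (\sum_(p <- [seq (c, b) | c <- smdivisors m,
                                       b <- smdivisors (smdiff m c)]) G' p).
  by apply/esym; rewrite big_allpairs_dep.
transitivity (\sum_(p <- [seq (c, smdiff a c) | a <- smdivisors m,
                                                c <- smdivisors a]) G' p).
  apply: perm_big; apply: uniq_perm.
  - apply: allpairs_uniq_dep => [|c _|]; rewrite ?smdivisors_uniq //.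
    by move=> [x1 y1] [x2 y2] _ _ /= [-> ->].
  - apply: allpairs_uniq_dep => [|c _|]; rewrite ?smdivisors_uniq //.
    move=> [a1 c1] [a2 c2] /=.
    move=> /allpairsPdep[a3 [c3 [am ca [? ?]]]].
    move=> /allpairsPdep[a4 [c4 [am' ca' [? ?]]]] E0; subst.
    have E := congr1 snd E0; have /= Ec := congr1 fst E0; move: E => /=; subst.
    move: am am' ca ca'; rewrite !mem_smdivisors => am am' ca ca' E.
    have [_ _ <-] := smdiff_le am ca; have [_ _ Ea] := smdiff_le am' ca'.
    by rewrite E Ea.
  - move=> [c b]; apply/allpairsPdep/allpairsPdep.
      move=> [c' [b' [+ + [-> ->]]]]; rewrite !mem_smdivisors => cm bm.
      have [? ? E ?] := smdiff_split cm bm.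
      by exists (smadd c' b'), c'; rewrite !mem_smdivisors E.
    move=> [a [c' [+ + [-> ->]]]]; rewrite !mem_smdivisors => am ca.
    have [? ? E] := smdiff_le am ca.
    by exists c', (smdiff a c'); rewrite !mem_smdivisors.
by rewrite big_allpairs_dep.
Qed.

Lemma ssmulA : associative ssmul.
Proof.
move=> f g h; apply/funext => m; rewrite !ssmulE.
under eq_bigr do rewrite ssmulE mulr_sumr.
rewrite (big_smdivisors m (fun c b => (-1) ^+ inversions c.2 (smdiff m c).2 * f c
  * ((-1) ^+ inversions b.2 (smdiff (smdiff m c) b).2 * g b
     * h (smdiff (smdiff m c) b)))).
rewrite big_seq [RHS]big_seq; apply: eq_bigr => a; rewrite mem_smdivisors => am.
rewrite ssmulE mulr_sumr mulr_suml big_seq [RHS]big_seq; apply: eq_bigr => c.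
rewrite mem_smdivisors => ca.
have [cm bm Ea] := smdiff_le am ca.
have [_ _ _ Em] := smdiff_split cm bm.
rewrite -Em Ea.
set s1 := inversions _ _; set s2 := inversions _ _.
set s3 := inversions _ _; set s4 := inversions _ _.
suff Es : (s1 + s2 = s3 + s4)%N.
  transitivity ((-1) ^+ (s1 + s2) * (f c * g (smdiff a c) * h (smdiff m a))).
    by rewrite exprD -!mulrA; congr (_ * _); rewrite mulrCA.
  by rewrite Es exprD !mulrA.
have [_ /fsubsetP a2] := smleP _ _ am; have [_ /fsubsetP c2] := smleP _ _ ca.
rewrite /s1 /s2 /s3 /s4 -{3}Ea.
have -> : (smdiff m c).2 = ((smdiff a c).2 `|` (smdiff m a).2)%fset.
  apply/fsetP => x; rewrite !inE; have := a2 x; have := c2 x.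
  case: (x \in c.2) => [/(_ isT) -> /(_ isT) -> //|_ /=].
  by case: (x \in a.2) => [/(_ isT) ->|].
rewrite inversionsUr; last first.
  by apply/fdisjointP => x; rewrite !inE => /andP[_ ->].
rewrite inversionsUl; last first.
  by apply/fdisjointP => x; rewrite !inE => ->.
by rewrite -addnA addnC.
Qed.

Lemma inversions0l (T : {fset W}) : inversions fset0 T = 0%N.
Proof. by rewrite /inversions big_seq_fset0. Qed.

Lemma inversions0r (T : {fset W}) : inversions T fset0 = 0%N.
Proof. by rewrite /inversions big1 // => i _; rewrite big_seq_fset0. Qed.

Lemma smle0 m : smle (smone V W) m.
Proof. by apply/smleP; rewrite msub0set fsub0set. Qed.
Lemma smlexx m : smle m m.
Proof. by apply/smleP; rewrite msubset_refl fsubset_refl. Qed.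
Lemma smdiff0 m : smdiff m (smone V W) = m.
Proof. by case: m => A S; rewrite /smdiff /= msetB0 fsetD0. Qed.
Lemma smdiffxx m : smdiff m m = smone V W.
Proof. by rewrite /smdiff msetBxx fsetDv. Qed.

Lemma ssmul_smonol a f m : ssmul (smono a) f m =
  if smle a m then (-1) ^+ inversions a.2 (smdiff m a).2 * f (smdiff m a) else 0.
Proof.
rewrite ssmulE; case: ifP => am.
  rewrite (bigD1_seq a) ?smdivisors_uniq ?mem_smdivisors //=.
  rewrite smonoE eqxx mulr1 big1 ?addr0 // => b /negPf nb.
  by rewrite smonoE nb mulr0 mul0r.
rewrite big_seq big1 // => b; rewrite mem_smdivisors smonoE.
by case: eqP => [->|_]; rewrite ?am // mulr0 mul0r.
Qed.

Lemma ssmul1l : left_id (smono (smone V W)) ssmul.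
Proof.
move=> f; apply/funext => m.
by rewrite ssmul_smonol smle0 inversions0l smdiff0 mul1r.
Qed.

Lemma ssmul1r : right_id (smono (smone V W)) ssmul.
Proof.
move=> f; apply/funext => m; rewrite ssmulE.
rewrite (bigD1_seq m) ?smdivisors_uniq ?mem_smdivisors ?smlexx //.
rewrite smdiffxx /= inversions0r smonoE eqxx mul1r mulr1 big_seq_cond big1 ?addr0 //.
move=> b; rewrite mem_smdivisors => /andP[bm nbm].
rewrite smonoE; case: eqP => [E|_]; last by rewrite mulr0.
have [_ _] := smdiff_le (smlexx m) bm.
by rewrite E /smadd msetD0 fsetU0 -surjective_pairing => /eqP; rewrite (negPf nbm).
Qed.

Lemma ssmulDl : left_distributive ssmul +%R.
Proof.
move=> f g h; apply/funext => m; rewrite ssD !ssmulE -big_split.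
by apply: eq_bigr => a _; rewrite ssD mulrDr mulrDl.
Qed.

Lemma ssmulDr : right_distributive ssmul +%R.
Proof.
move=> f g h; apply/funext => m; rewrite ssD !ssmulE -big_split.
by apply: eq_bigr => a _; rewrite ssD mulrDr.
Qed.

Lemma smone_neq0 : smono (smone V W) != 0 :> superseries.
Proof.
apply/eqP => /(congr1 (fun f : superseries => f (smone V W))).
by rewrite smonoE eqxx => /eqP; rewrite ss0 oner_eq0.
Qed.

HB.instance Definition _ := GRing.Zmodule_isNzRing.Build superseries
  ssmulA ssmul1l ssmul1r ssmulDl ssmulDr smone_neq0.

Lemma ssE1 m : (1 : superseries) m = (m == smone V W)%:R.
Proof. exact: smonoE. Qed.

Lemma ssM f g m : (f * g) m = \sum_(a <- smdivisors m)
     (-1) ^+ inversions a.2 (smdiff m a).2 * f a * g (smdiff m a).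
Proof. exact: ssmulE. Qed.

Lemma ssscalerAl (k : F) f g : k *: (f * g) = k *: f * g.
Proof.
apply/funext => m; rewrite ssZ !ssM mulr_sumr; apply: eq_bigr => a _.
by rewrite ssZ !mulrA [k * _]mulrC.
Qed.
HB.instance Definition _ :=
  GRing.Lmodule_isLalgebra.Build F superseries ssscalerAl.

Lemma ssscalerAr (k : F) f g : k *: (f * g) = f * (k *: g).
Proof.
apply/funext => m; rewrite ssZ !ssM mulr_sumr; apply: eq_bigr => a _.
by rewrite ssZ mulrCA.
Qed.
HB.instance Definition _ :=
  GRing.Lalgebra_isAlgebra.Build F superseries ssscalerAr.

Definition ssunit : pred superseries :=
  fun f => `[< exists g, g * f = 1 /\ f * g = 1 >].
Definition ssinv f : superseries :=
  xget f [set g : superseries | g * f = 1 /\ f * g = 1]%classic.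

Lemma ssinvP f : ssunit f -> ssinv f * f = 1 /\ f * ssinv f = 1.
Proof.
move=> /asboolP[g fg]; rewrite /ssinv.
by case: xgetP => [h _ //|/(_ g)]; case.
Qed.
Lemma ssmulVf : {in ssunit, left_inverse 1 ssinv *%R}.
Proof. by move=> f /ssinvP[]. Qed.
Lemma ssmulfV : {in ssunit, right_inverse 1 ssinv *%R}.
Proof. by move=> f /ssinvP[]. Qed.
Lemma ssunitP f g : g * f = 1 /\ f * g = 1 -> ssunit f.
Proof. by move=> fg; apply/asboolP; exists g. Qed.
Lemma ssinv_out : {in [predC ssunit], ssinv =1 id}.
Proof.
move=> f; rewrite inE => /asboolP nf; rewrite /ssinv.
by case: xgetP => // g _ fg; case: nf; exists g.
Qed.

HB.instance Definition _ := GRing.NzRing_hasMulInverse.Build superseries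
  ssmulVf ssmulfV ssunitP ssinv_out.

Lemma ssexp_deg f n m : f (smone V W) = 0 -> (smdeg m < n)%N -> (f ^+ n) m = 0.
Proof.
move=> f0; elim: n m => // n IHn m lt_mn; rewrite exprS ssM big_seq big1 // => a.
rewrite mem_smdivisors => /smdeg_diff Em.
have [a0|] := posnP (smdeg a).
  by move: a0 => /eqP; rewrite smdeg_eq0 => /eqP ->; rewrite f0 mulr0 mul0r.
move=> a_gt0; rewrite IHn ?mulr0 //.
by move: lt_mn; rewrite Em ltnS; apply: leq_trans; rewrite -[ltnLHS]add0n ltn_add2r.
Qed.

Lemma unitr_1B f : f (smone V W) = 0 -> 1 - f \is a GRing.unit.
Proof.
move=> f0; pose S n : superseries := \sum_(i < n) f ^+ i.
pose G : superseries := fun m => S (smdeg m).+1 m.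
have GE m n : (smdeg m < n)%N -> G m = S n m.
  move=> mn; rewrite /G /S -(subnKC mn).
  rewrite [in RHS]big_split_ord /= ssD [X in _ = _ + X]ss_sum.
  rewrite [X in _ = _ + X]big1 ?addr0 // => i _.
  by rewrite ssexp_deg //= addSn ltnS leq_addr.
have SE n : (1 - f) * S n = 1 - f ^+ n.
  by apply/oppr_inj; rewrite -mulNr !opprB subrX1.
have SC n : S n * (1 - f) = (1 - f) * S n.
  apply/esym/commr_sum => i _; apply/commr_sym/commrB; first exact: commr1.
  exact/commr_sym/commrX.
apply/unitrP; exists G; split; apply/funext => m; have lem := ltnSn (smdeg m).
- transitivity ((S (smdeg m).+1 * (1 - f)) m).
    rewrite !ssM big_seq [RHS]big_seq; apply: eq_bigr => a.
    rewrite mem_smdivisors => /smdeg_diff Em; rewrite (GE _ (smdeg m).+1) //.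
    by rewrite ltnS Em leq_addr.
  by rewrite SC SE ssD ssN ssexp_deg // subr0.
- transitivity (((1 - f) * S (smdeg m).+1) m).
    rewrite !ssM big_seq [RHS]big_seq; apply: eq_bigr => a.
    rewrite mem_smdivisors => /smdeg_diff Em; rewrite (GE _ (smdeg m).+1) //.
    by rewrite ltnS Em leq_addl.
  by rewrite SE ssD ssN ssexp_deg // subr0.
Qed.

(* Coefficientwise convergence (product of the discrete topologies) along the
   finite subsets of the index type. *)
Definition has_sum (I : choiceType) (u : I -> superseries) (s : superseries) :=
  forall m, exists A0 : {fset I}, forall A : {fset I}, (A0 `<=` A)%fset ->
    (\sum_(i <- A) u i) m = s m.

(* The ring is not commutative: this is only meaningful for families of pairwise
   commuting series, for which the order of the factors is irrelevant. *)
Definition has_prod (I : choiceType) (u : I -> superseries) (s : superseries) :=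
  forall m, exists A0 : {fset I}, forall A : {fset I}, (A0 `<=` A)%fset ->
    (\prod_(i <- A) u i) m = s m.

Definition summable (I : choiceType) (u : I -> superseries) : Prop :=
  exists s, has_sum u s.
Definition multipliable (I : choiceType) (u : I -> superseries) : Prop :=
  exists s, has_prod u s.

Definition infsum (I : choiceType) (u : I -> superseries) : superseries :=
  xget 0 [set s | has_sum u s]%classic.
Definition infprod (I : choiceType) (u : I -> superseries) : superseries :=
  xget 1 [set s | has_prod u s]%classic.

Lemma has_sum_unique (I : choiceType) (u : I -> superseries) s t :
  has_sum u s -> has_sum u t -> s = t.
Proof.
move=> us ut; apply/funext => m; have [A hA] := us m; have [B hB] := ut m.
by rewrite -(hA (A `|` B)%fset) ?fsubsetUl // (hB (A `|` B)%fset) // fsubsetUr.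
Qed.

Lemma has_prod_unique (I : choiceType) (u : I -> superseries) s t :
  has_prod u s -> has_prod u t -> s = t.
Proof.
move=> us ut; apply/funext => m; have [A hA] := us m; have [B hB] := ut m.
by rewrite -(hA (A `|` B)%fset) ?fsubsetUl // (hB (A `|` B)%fset) // fsubsetUr.
Qed.

Lemma infsumE (I : choiceType) (u : I -> superseries) s :
  has_sum u s -> infsum u = s.
Proof.
rewrite /infsum => us; case: xgetP => [t _ ut|/(_ s)] //.
exact: has_sum_unique ut us.
Qed.

Lemma infprodE (I : choiceType) (u : I -> superseries) s :
  has_prod u s -> infprod u = s.
Proof.
rewrite /infprod => us; case: xgetP => [t _ ut|/(_ s)] //.
exact: has_prod_unique ut us.
Qed.

Lemma summable_smono (I : choiceType) (e : I -> smonom V W) :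
  injective e -> summable (fun i => smono (e i)).
Proof.
move=> e_inj; exists (fun m => `[< exists i, e i = m >]%:R) => m.
have [[i Ei]|nex] := pselect (exists i, e i = m).
  exists [fset i]%fset => A; rewrite fsub1set => iA.
  rewrite ss_sum (bigD1_seq i) ?fset_uniq //= smonoE Ei eqxx big1 ?addr0.
    by case: asboolP => // -[]; exists i.
  by move=> j ji; rewrite smonoE -Ei (inj_eq e_inj) eq_sym (negPf ji).
exists fset0 => A _; rewrite ss_sum big1; first by case: asboolP.
by move=> j _; rewrite smonoE; case: eqP => // Em; case: nex; exists j.
Qed.

Definition evenvar (v : V) : superseries := smono ([mset v], fset0).
Definition oddvar (w : W) : superseries := smono (mset0, [fset w]%fset).

(* Linear extension of the reversal of a product of k anticommuting variables,
   which multiplies it by (-1)^(k(k-1)/2). *)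
Definition ssreverse f : superseries :=
  fun m => (-1) ^+ (#|` m.2| * (#|` m.2|).-1)./2 * f m.

Lemma smono_mul a b : [disjoint a.2 & b.2]%fset ->
  smono a * smono b = (-1) ^+ inversions a.2 b.2 *: smono (smadd a b).
Proof.
move=> dab; apply/funext => m; rewrite [LHS]ssmul_smonol ssZ !smonoE.
have bE : smdiff (smadd a b) a = b.
  case: b dab => b1 b2 /= dab; congr pair; rewrite /= ?msetDKB //.
  apply/fsetP => x; rewrite !inE; have /fdisjointP/(_ x) := dab.
  by case: (x \in a.2) => //= /(_ isT) /negPf ->.
case: (m =P smadd a b) => [->|nm].
  rewrite bE eqxx; suff -> : smle a (smadd a b) by [].
  apply/smleP; rewrite fsubsetUl; split=> //.
  by apply/msubsetP => x; rewrite msetE2 leq_addr.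
case: ifP => [am|]; rewrite mulr0 //; case: eqP => [E|_]; rewrite ?mulr0 //.
by case: nm; have [_ _] := smdiff_le (smlexx m) am; rewrite E.
Qed.

Lemma smono_mul0 a b : ~~ [disjoint a.2 & b.2]%fset -> smono a * smono b = 0.
Proof.
move=> nab; apply/funext => m; rewrite [LHS]ssmul_smonol ss0.
case: ifP => // am; rewrite smonoE; case: eqP => [E|_]; last by rewrite mulr0.
case/negP: nab; rewrite -E; apply/fdisjointP => x xa.
by rewrite !inE xa.
Qed.

Lemma evenvarC v w : evenvar v * evenvar w = evenvar w * evenvar v.
Proof.
have d0 : [disjoint (fset0 : {fset W}) & fset0]%fset by rewrite fdisjoint0X.
rewrite /evenvar smono_mul; last exact: d0.
rewrite smono_mul; last exact: d0.
by rewrite /smadd msetDC.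
Qed.

Lemma even_oddC v w : evenvar v * oddvar w = oddvar w * evenvar v.
Proof.
rewrite /evenvar /oddvar smono_mul; last exact: fdisjoint0X.
rewrite smono_mul; last exact: fdisjointX0.
by rewrite inversions0l inversions0r /smadd msetDC fsetUC.
Qed.

Lemma oddvar_sq w : oddvar w * oddvar w = 0.
Proof. by apply: smono_mul0; rewrite fdisjointX1 !inE eqxx. Qed.

Lemma oddvarC v w : oddvar v * oddvar w = - (oddvar w * oddvar v).
Proof.
have [->|neq] := eqVneq v w; first by rewrite oddvar_sq oppr0.
rewrite /oddvar smono_mul; last by rewrite fdisjointX1 inE eq_sym.
rewrite smono_mul; last by rewrite fdisjointX1 inE.
rewrite /smadd fsetUC -scaleNr; congr (_ *: _).
rewrite /inversions !big_seq_fset1.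
by move: neq; case: ltgtP => //= _ _; rewrite ?expr0 ?expr1 ?opprK.
Qed.

End SuperSeries.

Arguments evenvar F {V d} W v.
Arguments oddvar F V {d W} w.


(* Superpartitions, with the (irrelevant) trailing zeros of the second component
   removed: L.1 is the strictly decreasing part, L.2 the partition. *)
Definition is_superpartition (L : seq nat * seq nat) : bool :=
  [&& sorted gtn L.1, sorted geq L.2 & 0%N \notin L.2].

Record superpartition : Type := Superpartition {
  superpartition_val : seq nat * seq nat;
  _ : is_superpartition superpartition_val }.
HB.instance Definition _ := [isSub for superpartition_val].
HB.instance Definition _ := [Choice of superpartition by <:].

Definition sp_a (L : superpartition) : seq nat := (superpartition_val L).1.
Definition sp_s (L : superpartition) : seq nat := (superpartition_val L).2.

(* Parts k that do not occur contribute the factor 1. *)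
Definition zfactor (L : superpartition) : nat :=
  \prod_(k <- undup (sp_s L))
    (k ^ count_mem k (sp_s L) * (count_mem k (sp_s L))`!)%N.

(* The alphabet (x, theta) is tagged by false and (y, phi) by true; variables are
   numbered from 0.  The lexicographic order on the tagged indices only fixes
   which products of anticommuting variables are the basis monomials. *)
Notation bisuperseries F :=
  (superseries F (bool * nat)%type (bool *l nat)%type).

Section PowerSums.
Context (F : fieldType) (z : bool).

Definition cvar (i : nat) : bisuperseries F :=
  @evenvar F (bool * nat)%type _ (bool *l nat)%type (z, i).
Definition avar (i : nat) : bisuperseries F :=
  @oddvar F (bool * nat)%type _ (bool *l nat)%type (z, i).

(* Only meaningful for n > 0, the series being divergent for n = 0. *)
Definition powersum (n : nat) : bisuperseries F :=
  infsum (fun i => cvar i ^+ n).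

Definition tpowersum (n : nat) : bisuperseries F :=
  infsum (fun i => avar i * cvar i ^+ n).

Definition superpowersum (L : superpartition) : bisuperseries F :=
  \prod_(k <- sp_a L) tpowersum k * \prod_(k <- sp_s L) powersum k.

Lemma cvarX i n : cvar i ^+ n = smono F (msetn n (z, i), fset0).
Proof.
elim: n => [|n IHn]; first by rewrite expr0 msetn0.
rewrite exprS IHn /cvar /evenvar smono_mul; last exact: fdisjoint0X.
rewrite inversions0l scale1r; congr (smono F (_, _)); last exact: fsetU0.
by apply/msetP => v; rewrite !msetE2 !msetnE; case: eqP.
Qed.

Lemma avar_cvarX i n : avar i * cvar i ^+ n =
  smono F (msetn n (z, i), [fset ((z, i) : bool *l nat)%type]%fset).
Proof.
rewrite cvarX /avar /oddvar smono_mul; last exact: fdisjointX0.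
rewrite inversions0r scale1r; congr (smono F (_, _)); last exact: fsetU0.
exact: mset0D.
Qed.

Lemma powersum_summable n : (0 < n)%N -> summable (fun i => cvar i ^+ n).
Proof.
move=> n0; under [X in summable X]funext do rewrite cvarX.
apply: summable_smono => i j E; have /= := congr1 fst E.
by move=> /(msetn_inj n0) [].
Qed.

Lemma tpowersum_summable n : summable (fun i => avar i * cvar i ^+ n).
Proof.
under [X in summable X]funext do rewrite avar_cvarX.
apply: summable_smono => i j E; have /= := congr1 snd E.
by move=> /fset1_inj [].
Qed.

End PowerSums.

Section Kernel.
Context (F : fieldType).

Definition kernel_factor (ij : nat * nat) : bisuperseries F :=
  (1 - cvar F false ij.1 * cvar F true ij.2
     - avar F false ij.1 * avar F true ij.2)^-1.

Definition kernel : bisuperseries F := infprod kernel_factor.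

Lemma kernel_factor_unit i j :
  1 - cvar F false i * cvar F true j - avar F false i * avar F true j
    \is a GRing.unit.
Proof.
rewrite -addrA -opprD; apply: unitr_1B.
rewrite ssD /cvar /avar /evenvar /oddvar smono_mul; last exact: fdisjoint0X.
rewrite smono_mul; last by rewrite fdisjointX1 inE.
rewrite !ssZ !smonoE /smone /smadd !xpair_eqE.
have -> : (mset0 == [mset (false, i)] `+` [mset (true, j)]) = false.
  apply/negP => /eqP/msetP/(_ (true, j)).
  by rewrite mset0E msetE2 !msetnE eqxx addn1.
have -> : (fset0 == [fset ((false, i) : bool *l nat)%type]
    `|` [fset ((true, j) : bool *l nat)%type])%fset = false.
  apply/negP => /eqP/fsetP/(_ (true, j)).
  by rewrite !inE eqxx orbT.
by rewrite !andbF !mulr0 addr0.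
Qed.

End Kernel.

(* Main.v *)
(** The Euler operator [D], multiplying each monomial by its total degree, is a
    derivation, so in characteristic 0 a series [f] with [D f = f g] and [g]
    without constant term is determined by [g] and its constant term.  Both sides
    of the identity satisfy this equation with
    [g = 2 sum_(k >= 0) (p_(k+1)(x) p_(k+1)(y) + (k+1) tp_k(x) tp_k(y))].
    For the product, a factor [1 / (1 - w)] with [w = x y + theta phi] has
    logarithmic derivative [2 w / (1 - w)], and since [(theta phi)^2 = 0],
    [w^(k+1) = (x y)^(k+1) + (k+1) theta phi (x y)^k].  For the sum, reordering the
    odd power sums turns the term of [L] into [z_L^-1] times a product of the
    commuting elements [p_k(x) p_k(y)] and [tp_k(x) tp_k(y)], and multiplying by one
    of them adds a part to [L].  Infinite sums and products are replaced by finite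
    ones modulo the series having no monomial that divides a given [m]. *)
Require Import Defs.
From HB Require Import structures.
From mathcomp Require Import all_boot all_order all_algebra.
From mathcomp Require Import finmap multiset.
From mathcomp Require Import boolp classical_sets functions.

Set Implicit Arguments.
Unset Strict Implicit.
Unset Printing Implicit Defensive.

Import Order.TTheory GRing.Theory.
Local Open Scope ring_scope.

(** * Divisors of a monomial, and the sign of an exchange *)

Section Divisors.
Context (V : choiceType) (d : Order.disp_t) (W : orderType d).
Implicit Types (a b m : smonom V W) (S T : {fset W}).

Lemma smle_trans a b m : smle a b -> smle b m -> smle a m.
Proof. by move=> ab bm; have [] := smdiff_le bm ab. Qed.

Lemma smle_diff a m : smle (smdiff m a) m.
Proof. by apply/smleP; rewrite msubsetDl fsubsetDl. Qed.

Lemma smdiffK a m : smle a m -> smdiff m (smdiff m a) = a.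
Proof.
case: a => A S /smleP[/= Am Sm]; rewrite /smdiff /=; congr pair.
  by rewrite msetBBK.
by rewrite fsetDK.
Qed.

(** Passing to the complementary divisor is an involution on the divisors of [m]. This reindexes the
    product of two series so that its factors trade places. *)
Lemma perm_smdivisors m :
  perm_eq (smdivisors m) [seq smdiff m a | a <- smdivisors m].
Proof.
apply: uniq_perm; first exact: smdivisors_uniq.
  rewrite map_inj_in_uniq ?smdivisors_uniq // => a b.
  rewrite !mem_smdivisors => am bm E.
  by rewrite -(smdiffK am) E smdiffK.
move=> a; rewrite mem_smdivisors; apply/idP/mapP => [am|[b + ->]].
  by exists (smdiff m a); rewrite ?smdiffK // mem_smdivisors smle_diff.
by rewrite smle_diff.
Qed.

(** By disjointness, each pair of [S] and [T] is out of order in exactly one of the two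
    arrangements. Hence the two signs differ by the parity of the product of the cardinals. *)
Lemma inversionsC S T : [disjoint S & T]%fset ->
  (inversions S T + inversions T S = #|` S| * #|` T|)%N.
Proof.
move=> /fdisjointP dST.
rewrite /inversions [X in (_ + X)%N]exchange_big -big_split /=.
rewrite [RHS](_ : _ = \sum_(s <- S) #|` T|)%N; last first.
  by rewrite big_const_seq iter_addn_0 count_predT mulnC.
rewrite big_seq [RHS]big_seq; apply: eq_bigr => s /dST sT.
rewrite -big_split /= -[RHS]sum1_size big_seq [RHS]big_seq; apply: eq_bigr => t tT.
by case: ltgtP => // st; move: sT; rewrite -st tT.
Qed.

Lemma smdeg_one : smdeg (smone V W) = 0%N.
Proof. by apply/eqP; rewrite smdeg_eq0. Qed.

Lemma smle_one a : smle a (smone V W) -> a = smone V W.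
Proof.
move=> /smdeg_diff; rewrite smdeg_one => /esym/eqP.
by rewrite addn_eq0 smdeg_eq0 => /andP[/eqP].
Qed.

Definition odddeg m : nat := #|` m.2|.

Lemma odddeg_diff m a :
  smle a m -> odddeg m = (odddeg a + odddeg (smdiff m a))%N.
Proof. by move=> /smleP[_ a2]; rewrite /odddeg -(cardfsID a.2 m.2) (fsetIidPr a2). Qed.

End Divisors.

(** * Truncation, gradings and the Euler operator on series *)

Section Series.
Context (F : fieldType) (V : choiceType) (d : Order.disp_t) (W : orderType d).
Notation SS := (superseries F V W).
Implicit Types (f g h : SS) (m a b : smonom V W).

(* Congruence modulo the ideal of the series with no monomial dividing m. *)
Definition eqm m f g := forall a, smle a m -> f a = g a.

Lemma eqm_refl m f : eqm m f f. Proof. by []. Qed.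

Lemma eqm_sym m f g : eqm m f g -> eqm m g f.
Proof. by move=> E a am; rewrite E. Qed.

Lemma eqm_trans m f g h : eqm m f g -> eqm m g h -> eqm m f h.
Proof. by move=> E1 E2 a am; rewrite E1 ?E2. Qed.

Lemma eqmD m f f' g g' : eqm m f f' -> eqm m g g' -> eqm m (f + g) (f' + g').
Proof. by move=> E1 E2 a am; rewrite !ssD E1 ?E2. Qed.

(** The coefficient of a product at [a] only involves divisors of [a], which still divide [m]. *)
Lemma eqmM m f f' g g' : eqm m f f' -> eqm m g g' -> eqm m (f * g) (f' * g').
Proof.
move=> E1 E2 a am; rewrite !ssM big_seq [RHS]big_seq; apply: eq_bigr => b.
rewrite mem_smdivisors => ba; rewrite E1 ?E2 ?(smle_trans _ am) //.
exact: smle_diff.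
Qed.

Lemma eqmZ m k f f' : eqm m f f' -> eqm m (k *: f) (k *: f').
Proof. by move=> E a am; rewrite !ssZ E. Qed.

Lemma eqm_sum m (I : eqType) (r : seq I) (u v : I -> SS) :
  {in r, forall i, eqm m (u i) (v i)} ->
  eqm m (\sum_(i <- r) u i) (\sum_(i <- r) v i).
Proof.
move=> E a am; rewrite !ss_sum big_seq [RHS]big_seq.
by apply: eq_bigr => i ir; rewrite E.
Qed.

Lemma eqm_sum_fsubset m (I : choiceType) (A B : {fset I}) (u : I -> SS) :
  (A `<=` B)%fset -> (forall i, i \notin A -> eqm m (u i) 0) ->
  eqm m (\sum_(i <- B) u i) (\sum_(i <- A) u i).
Proof.
move=> AB u0 a am; rewrite !ss_sum; apply/esym/big_fset_incl => // i _ iA.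
by rewrite u0.
Qed.

Lemma infsum_has_sum (I : choiceType) (u : I -> SS) :
  summable u -> has_sum u (infsum u).
Proof. by move=> [s us]; rewrite (infsumE us). Qed.

Lemma eqm_infsum m (I : choiceType) (A : {fset I}) (u : I -> SS) :
  summable u -> (forall i, i \notin A -> eqm m (u i) 0) ->
  eqm m (infsum u) (\sum_(i <- A) u i).
Proof.
move=> /infsum_has_sum us u0 a am; have [B BE] := us a.
rewrite -(BE (A `|` B)%fset) ?fsubsetUr //.
exact: (eqm_sum_fsubset (fsubsetUl _ _) u0).
Qed.

(** The weight is a parameter because two gradings are used: the total degree, and the number of
    anticommuting variables. *)
Definition homogeneous (w : smonom V W -> nat) n f :=
  forall m, w m != n -> f m = 0.

Section Homogeneous.
Context (w : smonom V W -> nat).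
Hypothesis w_diff : forall m a, smle a m -> w m = (w a + w (smdiff m a))%N.

Lemma homogeneous_smono n a : w a = n -> homogeneous w n (smono F a).
Proof.
by move=> <- m; rewrite smonoE; case: (m =P a) => // ->; rewrite eqxx.
Qed.

Lemma homogeneous1 : homogeneous w 0 1.
Proof.
move=> m; rewrite ssE1; case: (m =P _) => // -> /negP[].
(* The empty monomial divides itself with itself as quotient, so its weight [c] satisfies
   [c = c + c] and is 0. *)
by have := w_diff (smlexx (smone V W)); rewrite smdiffxx -[LHS]addn0 => /addnI <-.
Qed.

Lemma homogeneousM i j f g :
  homogeneous w i f -> homogeneous w j g -> homogeneous w (i + j)%N (f * g).
Proof.
move=> hf hg m wm; rewrite ssM big_seq big1 // => a; rewrite mem_smdivisors => am.
have [ai|ai] := eqVneq (w a) i; last by rewrite hf // mulr0 mul0r.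
rewrite [g _]hg ?mulr0 //; apply: contraNneq wm => aj.
by rewrite (w_diff am) ai aj.
Qed.

Lemma homogeneousZ i k f : homogeneous w i f -> homogeneous w i (k *: f).
Proof. by move=> hf m /hf fm; rewrite ssZ fm mulr0. Qed.

Lemma homogeneous_prod (I : Type) (s : seq I) (n : I -> nat) (u : I -> SS) :
  (forall i, homogeneous w (n i) (u i)) ->
  homogeneous w (\sum_(i <- s) n i)%N (\prod_(i <- s) u i).
Proof.
move=> hu; elim: s => [|i s IHs]; first by rewrite !big_nil; exact: homogeneous1.
by rewrite !big_cons; apply: homogeneousM.
Qed.

Lemma homogeneous_infsum (I : choiceType) n (u : I -> SS) :
  (forall i, homogeneous w n (u i)) -> homogeneous w n (infsum u).
Proof.
(* If the family has no sum, [infsum] is its default value 0, which is homogeneous of every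
   degree. *)
move=> hu m wm; rewrite /infsum; case: xgetP => // s _ us.
have [A /(_ A (fsubset_refl A)) <-] := us m.
by rewrite ss_sum big1 // => i _; rewrite hu.
Qed.

End Homogeneous.

Notation oddhomog := (homogeneous (@odddeg _ _ _)).

(** The sign rule of a superalgebra. After exchanging each divisor with its complement, the two
    products agree term by term up to the sign given by [inversionsC]. *)
Lemma oddhomogC i j f g : oddhomog i f -> oddhomog j g ->
  f * g = (-1) ^+ (i * j) *: (g * f).
Proof.
move=> hf hg; apply/funext => m; rewrite ssZ !ssM mulr_sumr.
rewrite (perm_big _ (perm_smdivisors m)) big_map big_seq [RHS]big_seq.
apply: eq_bigr => a; rewrite mem_smdivisors => am; rewrite (smdiffK am).
have [ai|ai] := eqVneq (odddeg (smdiff m a)) i; last first.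
  by rewrite [f _]hf // !(mulr0, mul0r).
have [aj|aj] := eqVneq (odddeg a) j; last by rewrite [g _]hg // !(mulr0, mul0r).
rewrite -mulrA -[X in _ = _ * X]mulrA [g _ * _]mulrC [RHS]mulrA -exprD.
rewrite -ai -aj; congr (_ * _); set b := smdiff m a.
have /inversionsC E : [disjoint b.2 & a.2]%fset.
  by apply/fdisjointP => x; rewrite inE => /andP[].
rewrite -signr_odd -E -[RHS]signr_odd oddD oddD.
by case: (odd _); case: (odd _).
Qed.

Lemma oddhomog0_comm i f g : oddhomog 0 f -> oddhomog i g -> GRing.comm f g.
Proof. by move=> hf hg; rewrite /GRing.comm (oddhomogC hf hg) mul0n scale1r. Qed.

Lemma oddhomog_even_comm i j f g :
  ~~ odd (i * j) -> oddhomog i f -> oddhomog j g -> GRing.comm f g.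
Proof.
move=> /negPf e hf hg; rewrite /GRing.comm (oddhomogC hf hg).
by rewrite -signr_odd e scale1r.
Qed.

Lemma ssreverse_oddhomog n f :
  oddhomog n f -> ssreverse f = (-1) ^+ 'C(n, 2) *: f.
Proof.
move=> hf; apply/funext => m; rewrite ssZ /ssreverse bin2 -/(odddeg m).
by have [->//|/hf ->] := eqVneq (odddeg m) n; rewrite !mulr0.
Qed.

Definition euler f : SS := fun m => (smdeg m)%:R * f m.

Lemma eulerE f m : euler f m = (smdeg m)%:R * f m. Proof. by []. Qed.

Lemma eulerD f g : euler (f + g) = euler f + euler g.
Proof. by apply/funext => m; rewrite eulerE !ssD mulrDr. Qed.

Lemma euler0 : euler 0 = 0.
Proof. by apply/funext => m; rewrite eulerE mulr0. Qed.

Lemma euler_sum (I : Type) (r : seq I) (u : I -> SS) :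
  euler (\sum_(i <- r) u i) = \sum_(i <- r) euler (u i).
Proof. exact: (big_morph euler eulerD euler0). Qed.

Lemma eulerM f g : euler (f * g) = euler f * g + f * euler g.
Proof.
apply/funext => m; rewrite eulerE ssD !ssM mulr_sumr -big_split /=.
rewrite big_seq [RHS]big_seq; apply: eq_bigr => a; rewrite mem_smdivisors => am.
rewrite !eulerE (smdeg_diff am) natrD mulrDl; congr (_ + _).
  by rewrite !mulrA; congr (_ * _ * _); rewrite mulrC.
by rewrite mulrCA.
Qed.

Lemma euler_homogeneous n f :
  homogeneous (@smdeg V d W) n f -> euler f = n%:R *: f.
Proof.
move=> hf; apply/funext => m; rewrite eulerE ssZ.
by have [->//|/hf ->] := eqVneq (smdeg m) n; rewrite !mulr0.
Qed.

Lemma euler1 : euler 1 = 0.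
Proof.
by rewrite (@euler_homogeneous 0) ?scale0r //; apply/homogeneous1/smdeg_diff.
Qed.

(** At [a], the equation expresses [deg a] times the coefficient of [f] through the coefficients at
    divisors of [a]. Since [g] has no constant term, only proper divisors contribute, so induction
    on the degree applies; characteristic 0 allows the division by [deg a]. *)
Lemma euler_solution_unique m f f' g g' : [pchar F] =i pred0 ->
    f (smone V W) = f' (smone V W) -> g (smone V W) = 0 ->
    eqm m (euler f) (f * g) -> eqm m (euler f') (f' * g') -> eqm m g g' ->
  eqm m f f'.
Proof.
move=> /pcharf0P char0 f1 g1 ef ef' gg' a am.
have [n] := ubnP (smdeg a); elim: n => // n IHn in a am *; rewrite ltnS => an.
have [->//|a1] := eqVneq a (smone V W).
have da0 : (smdeg a)%:R != 0 :> F by rewrite char0 smdeg_eq0.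
apply: (mulfI da0); rewrite -!eulerE ef // ef' // !ssM big_seq [RHS]big_seq.
apply: eq_bigr => b; rewrite mem_smdivisors => ba.
rewrite -gg'; last exact: smle_trans (smle_diff _ _) am.
have [b0|b0] := eqVneq (smdiff a b) (smone V W); first by rewrite b0 g1 !mulr0.
rewrite IHn //; first exact: smle_trans ba am.
by apply: leq_trans an; rewrite (smdeg_diff ba) -[ltnLHS]addn0 ltn_add2l lt0n smdeg_eq0.
Qed.

End Series.

Notation oddhomog := (homogeneous (@odddeg _ _ _)).

(** * Reindexing, multiplicities and enumeration of sequences *)

Lemma reindex_seq (R : nmodType) (I : eqType) (r : seq I) (P Q : pred I)
    (h h' : I -> I) (G : I -> R) :
    uniq r ->
    {in r, forall i, P i -> [/\ h i \in r, Q (h i) & h' (h i) = i]} ->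
    {in r, forall i, Q i -> [/\ h' i \in r, P (h' i) & h (h' i) = i]} ->
  \sum_(i <- r | P i) G (h i) = \sum_(i <- r | Q i) G i.
Proof.
move=> r_uniq hP hQ; rewrite -big_filter -[RHS]big_filter -(big_map h predT G).
apply: perm_big; apply: uniq_perm; rewrite ?filter_uniq //.
  rewrite map_inj_in_uniq ?filter_uniq // => i j; rewrite !mem_filter.
  move=> /andP[Pi ri] /andP[Pj rj] E.
  by have [_ _ <-] := hP _ ri Pi; have [_ _ <-] := hP _ rj Pj; rewrite E.
move=> i; rewrite mem_filter; apply/mapP/andP => [[j + ->]|[Qi ri]].
  by rewrite mem_filter => /andP[Pj rj]; have [] := hP _ rj Pj.
by have [h'r Ph' hh'] := hQ _ ri Qi; exists (h' i); rewrite // mem_filter Ph'.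
Qed.

Lemma sum_count_mem (s : seq nat) N (f : nat -> nat) : all (fun j => j < N)%N s ->
  (\sum_(j <- s) f j = \sum_(k < N) count_mem (k : nat) s * f k)%N.
Proof.
move=> /allP s_lt; transitivity (\sum_(j <- s) \sum_(k < N) (j == k) * f k)%N.
  rewrite big_seq [RHS]big_seq; apply: eq_bigr => j /s_lt j_lt.
  rewrite (bigD1 (Ordinal j_lt)) //= eqxx mul1n big1 ?addn0 // => k.
  by rewrite -val_eqE eq_sym => /negPf ->.
rewrite exchange_big; apply: eq_bigr => k _.
rewrite -big_distrl /=; congr (_ * _)%N.
by elim: s {s_lt} => [|j s IHs]; rewrite ?big_nil // big_cons IHs.
Qed.

Lemma leq_sum_mem (s : seq nat) (f : nat -> nat) k :
  k \in s -> (f k <= \sum_(j <- s) f j)%N.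
Proof. by move=> ks; rewrite (big_rem k ks) leq_addr. Qed.

Definition bounded_seqs N : seq (seq nat) :=
  flatten [seq [seq map val (val t) | t <- enum {: k.-tuple 'I_N.+1}]
          | k <- iota 0 N.+1].

Lemma mem_bounded_seqs N s :
  (size s <= N)%N -> {in s, forall j, j <= N}%N -> s \in bounded_seqs N.
Proof.
move=> sN s_le; apply/flattenP.
exists [seq map val (val t) | t <- enum {: (size s).-tuple 'I_N.+1}].
  by apply/mapP; exists (size s); rewrite // mem_iota.
apply/mapP; exists [tuple of map inord (in_tuple s)]; first by rewrite mem_enum.
rewrite /= -map_comp -[LHS]map_id; apply/eq_in_map => j /s_le jN.
by rewrite /= inordK.
Qed.

(** * Superpartitions of bounded degree; adding and removing parts *)

Section Superpartitions.
Implicit Types (L : superpartition) (k N : nat).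

Lemma sp_inj L L' : sp_a L = sp_a L' -> sp_s L = sp_s L' -> L = L'.
Proof.
move=> Ea Es; apply: val_inj => /=.
by rewrite [LHS]surjective_pairing [RHS]surjective_pairing; congr pair.
Qed.

Lemma sp_a_sorted L : sorted gtn (sp_a L).
Proof. by rewrite /sp_a; case: L => ? /= /and3P[]. Qed.

Lemma sp_s_sorted L : sorted geq (sp_s L).
Proof. by rewrite /sp_s; case: L => ? /= /and3P[]. Qed.

Lemma sp_s_neq0 L : 0%N \notin sp_s L.
Proof. by rewrite /sp_s; case: L => ? /= /and3P[]. Qed.

Lemma sp_a_uniq L : uniq (sp_a L).
Proof. by have := sp_a_sorted L; rewrite gtn_sorted_uniq_geq => /andP[]. Qed.

Lemma geq_anti : antisymmetric geq.
Proof. by move=> i j; rewrite andbC => /anti_leq. Qed.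

Lemma geq_trans : transitive geq.
Proof. by move=> i j k ij jk; apply: leq_trans ij. Qed.

Lemma geq_total : total geq.
Proof. by move=> i j; apply: leq_total. Qed.

Lemma geq_sorted_eq s t : sorted geq s -> sorted geq t -> perm_eq s t -> s = t.
Proof. exact: (sorted_eq geq_trans geq_anti). Qed.

(* The total degree, even and odd variables together, of [superpowersum F z L]. *)
Definition spdeg L : nat :=
  (\sum_(k <- sp_a L) k.+1 + \sum_(k <- sp_s L) k)%N.

Definition sp_set N : {fset superpartition} :=
  [fset L in pmap insub [seq (s, t) | s <- bounded_seqs N, t <- bounded_seqs N]
     | (spdeg L <= N)%N]%fset.

(** Every part contributes at least 1 to [spdeg], a part [k] of [sp_a] counting as [k.+1] and the
    parts of [sp_s] being nonzero. A bound on the degree therefore bounds both the number and the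
    size of the parts, and [bounded_seqs] misses none. *)
Lemma in_sp_set N L : (L \in sp_set N) = (spdeg L <= N)%N.
Proof.
rewrite !inE /= andbC; case: leqP => //= LN; rewrite mem_pmap_sub /=.
have [aN sN] : (\sum_(k <- sp_a L) k.+1 <= N)%N /\ (\sum_(k <- sp_s L) k <= N)%N.
  by split; apply: leq_trans LN; rewrite ?leq_addr ?leq_addl.
rewrite [superpartition_val L]surjective_pairing.
apply: (allpairs_f (fun s t : seq nat => (s, t))).
  apply: mem_bounded_seqs => [|k ka].
    by apply: leq_trans aN; rewrite -sum1_size leq_sum.
  by apply: ltnW; apply: leq_trans aN; apply: (leq_sum_mem succn).
apply: mem_bounded_seqs => [|k ks]; last first.
  by apply: leq_trans sN; apply: (leq_sum_mem id).
apply: leq_trans sN; rewrite -sum1_size big_seq [leqRHS]big_seq leq_sum // => k ks.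
by rewrite lt0n; apply: contraNneq (sp_s_neq0 L) => <-.
Qed.

Fact sp_rem_s_subproof k L : is_superpartition (sp_a L, rem k (sp_s L)).
Proof.
apply/and3P; split => /=; first exact: sp_a_sorted.
  exact: (subseq_sorted geq_trans (rem_subseq _ _) (sp_s_sorted L)).
by apply: contra (sp_s_neq0 L); apply: mem_rem.
Qed.
Definition sp_rem_s k L := Superpartition (sp_rem_s_subproof k L).

Fact sp_add_s_subproof k L : is_superpartition (sp_a L, sort geq (k.+1 :: sp_s L)).
Proof.
apply/and3P; split => /=; first exact: sp_a_sorted.
  exact: (sort_sorted geq_total).
by rewrite mem_sort inE negb_or sp_s_neq0.
Qed.
(** The index is shifted: the new part is [k.+1], never 0, whereas [sp_rem_s k] removes [k]
    itself. *)
Definition sp_add_s k L := Superpartition (sp_add_s_subproof k L).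

Fact sp_rem_a_subproof k L : is_superpartition (rem k (sp_a L), sp_s L).
Proof.
apply/and3P; split => /=; rewrite ?sp_s_sorted ?sp_s_neq0 //.
apply: (subseq_sorted _ (rem_subseq _ _) (sp_a_sorted L)).
by move=> i j l ij jl; apply: ltn_trans ij.
Qed.
Definition sp_rem_a k L := Superpartition (sp_rem_a_subproof k L).

Fact sp_add_a_subproof k L :
  is_superpartition (sort geq (undup (k :: sp_a L)), sp_s L).
Proof.
apply/and3P; split => /=; rewrite ?sp_s_sorted ?sp_s_neq0 //.
rewrite gtn_sorted_uniq_geq sort_uniq sort_sorted; last exact: geq_total.
by rewrite andbT (undup_uniq (k :: _)).
Qed.
(** The [undup] makes the operation total: a part already present is not repeated. *)
Definition sp_add_a k L := Superpartition (sp_add_a_subproof k L).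

Lemma spdeg_rem_s k L : k \in sp_s L -> spdeg L = (spdeg (sp_rem_s k L) + k)%N.
Proof. by move=> ks; rewrite /spdeg (big_rem k ks) /= -addnA [(_ + k)%N]addnC. Qed.

Lemma spdeg_rem_a k L : k \in sp_a L -> spdeg L = (spdeg (sp_rem_a k L) + k.+1)%N.
Proof. by move=> ka; rewrite /spdeg (big_rem k ka) /= -addnA addnC. Qed.

Lemma sp_add_sK k L : sp_rem_s k.+1 (sp_add_s k L) = L.
Proof.
apply: sp_inj => //; apply: geq_sorted_eq; try exact: sp_s_sorted.
rewrite -(perm_cons k.+1) -(permPl (perm_to_rem _)); first by rewrite perm_sort.
by rewrite mem_sort mem_head.
Qed.

Lemma sp_rem_sK k L : k.+1 \in sp_s L -> sp_add_s k (sp_rem_s k.+1 L) = L.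
Proof.
move=> ks; apply: sp_inj => //; apply: geq_sorted_eq; try exact: sp_s_sorted.
by rewrite perm_sort perm_sym; apply: perm_to_rem.
Qed.

Lemma geq_sp_a_sorted L : sorted geq (sp_a L).
Proof. by have := sp_a_sorted L; rewrite gtn_sorted_uniq_geq => /andP[]. Qed.

Lemma mem_sp_add_a k L : k \in sp_a (sp_add_a k L).
Proof.
rewrite mem_sort /= undup_id ?sp_a_uniq //.
by case: ifP => // _; rewrite mem_head.
Qed.

Lemma sp_add_aK k L : k \notin sp_a L -> sp_rem_a k (sp_add_a k L) = L.
Proof.
move=> ka; apply: sp_inj => //; apply: geq_sorted_eq; try exact: geq_sp_a_sorted.
rewrite -(perm_cons k) -(permPl (perm_to_rem _)); last exact: mem_sp_add_a.
by rewrite perm_sort /= (negPf ka) undup_id ?sp_a_uniq.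
Qed.

Lemma sp_rem_aK k L : k \in sp_a L -> sp_add_a k (sp_rem_a k L) = L.
Proof.
move=> ka; apply: sp_inj => //; apply: geq_sorted_eq; try exact: geq_sp_a_sorted.
rewrite perm_sort (permPr (perm_to_rem ka)) undup_id //=.
by rewrite rem_uniq ?sp_a_uniq // mem_rem_uniq ?sp_a_uniq // inE eqxx.
Qed.

(** Removing one part [k.+1] is a bijection with inverse [sp_add_s k]. The degree condition on the
    right says that the part can be put back without leaving [sp_set N]. *)
Lemma big_sp_rem_s (R : nmodType) N k (G : superpartition -> R) :
  \sum_(L <- sp_set N | k.+1 \in sp_s L) G (sp_rem_s k.+1 L) =
  \sum_(L <- sp_set N | (spdeg L + k.+1 <= N)%N) G L.
Proof.
apply: (reindex_seq (h' := sp_add_s k)); first exact: fset_uniq.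
  move=> L; rewrite !in_sp_set => LN ks; rewrite -(spdeg_rem_s ks) LN sp_rem_sK //.
  by split=> //; apply: leq_trans LN; rewrite (spdeg_rem_s ks) leq_addr.
move=> L; rewrite !in_sp_set => LN LkN; have ks : k.+1 \in sp_s (sp_add_s k L).
  by rewrite mem_sort mem_head.
by split; rewrite ?sp_add_sK // (spdeg_rem_s ks) sp_add_sK.
Qed.

Lemma big_sp_rem_a (R : nmodType) N k (G : superpartition -> R) :
  \sum_(L <- sp_set N | k \in sp_a L) G (sp_rem_a k L) =
  \sum_(L <- sp_set N | (k \notin sp_a L) && (spdeg L + k.+1 <= N)%N) G L.
Proof.
apply: (reindex_seq (h' := sp_add_a k)); first exact: fset_uniq.
  move=> L; rewrite !in_sp_set => LN ka; rewrite -(spdeg_rem_a ka) LN sp_rem_aK //.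
  rewrite [sp_a _]/= mem_rem_uniq ?sp_a_uniq // inE eqxx.
  by split=> //; apply: leq_trans LN; rewrite (spdeg_rem_a ka) leq_addr.
move=> L; rewrite !in_sp_set => LN /andP[nka LkN].
have ka : k \in sp_a (sp_add_a k L) by exact: mem_sp_add_a.
by split; rewrite ?sp_add_aK // (spdeg_rem_a ka) sp_add_aK.
Qed.

(** Splits the degree according to the value of the parts, so that each [k] can be matched with one
    summand of [klog]. *)
Lemma spdeg_count N L : (spdeg L <= N)%N ->
  spdeg L = (\sum_(k < N) (k.+1 * (val k \in sp_a L))
    + \sum_(k < N) (k.+1 * count_mem k.+1 (sp_s L)))%N.
Proof.
move=> LN; rewrite /spdeg; congr (_ + _)%N.
  rewrite (sum_count_mem (N := N)); last first.
    apply/allP => k ka; apply: leq_trans LN; apply: leq_trans (leq_addr _ _).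
    exact: (leq_sum_mem succn).
  by apply: eq_bigr => k _; rewrite mulnC count_uniq_mem ?sp_a_uniq.
rewrite (sum_count_mem (N := N.+1)); last first.
  apply/allP => k ks; rewrite ltnS; apply: leq_trans LN;
    apply: leq_trans (leq_addl _ _).
  exact: (leq_sum_mem id).
(* The value 0 contributes nothing; dropping it leaves the values from 1 to [N]. *)
by rewrite big_ord_recl muln0 add0n; apply: eq_bigr => k _; rewrite mulnC.
Qed.

(** Only the factor of [k] changes: with multiplicity [c > 0], [k^c c!] is [k c] times
    [k^(c-1) (c-1)!]. *)
Lemma zfactor_rem k L : k \in sp_s L ->
  zfactor L = (k * count_mem k (sp_s L) * zfactor (sp_rem_s k L))%N.
Proof.
move=> ks; rewrite /zfactor [sp_s (sp_rem_s _ _)]/=.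
set s := sp_s L; pose z (t : seq nat) j := (j ^ count_mem j t * (count_mem j t)`!)%N.
(* The value [k] may disappear from [rem k s], but its factor is then [k^0 0! = 1], so both products
   can run over [undup s]. *)
have -> : (\prod_(j <- undup (rem k s)) z (rem k s) j
    = \prod_(j <- undup s) z (rem k s) j)%N.
  rewrite [RHS](bigID (mem (rem k s))) /= [X in (_ * X)%N]big1 ?muln1; last first.
    by move=> j /count_memPn; rewrite /z => ->.
  rewrite -[RHS]big_filter; apply: perm_big; apply: uniq_perm.
  - exact: undup_uniq.
  - by rewrite filter_uniq ?undup_uniq.
  move=> j; rewrite mem_filter !mem_undup.
  by case: (boolP (j \in rem k s)) => //= /mem_rem ->.
have ku : k \in undup s by rewrite mem_undup.
rewrite (bigD1_seq k) ?undup_uniq //= [in RHS](bigD1_seq k) ?undup_uniq //= mulnA.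
congr (_ * _)%N; last first.
  apply: eq_bigr => j jk; rewrite /z count_rem ks /= [k == j]eq_sym (negPf jk).
  by rewrite subn0.
rewrite /z count_rem ks /= eqxx subn1.
have : (0 < count_mem k s)%N by rewrite -has_count has_pred1.
by case: (count_mem k s) => // c _; rewrite /= expnS factS mulnACA.
Qed.

End Superpartitions.

Lemma prod_rem_comm (R : nzRingType) (I : eqType) (s : seq I) k (u : I -> R) :
    (forall i j, GRing.comm (u i) (u j)) -> k \in s ->
  \prod_(i <- s) u i = \prod_(i <- rem k s) u i * u k.
Proof.
move=> uC; elim: s => // i s IHs; rewrite inE big_cons /=.
have [-> _|ik] := eqVneq k i; last first.
  by rewrite /= => /IHs ->; rewrite big_cons mulrA.
by apply: commr_prod => j _; apply: uC.
Qed.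

(** * The terms of the sum and the Euler equation of its truncations *)

Section PowerSumTerms.
Context (F : fieldType).
Notation BS := (bisuperseries F).
Notation deg := (@smdeg (bool * nat)%type _ (bool *l nat)%type).
Implicit Types (L : superpartition) (z : bool) (k n N : nat).

Lemma size_msetn (T : choiceType) n (v : T) : size (msetn n v) = n.
Proof. by rewrite enum_msetn size_nseq. Qed.

Lemma powersum_homogeneous z n : homogeneous deg n (powersum F z n).
Proof.
apply: homogeneous_infsum => i; rewrite cvarX; apply: homogeneous_smono.
by rewrite /smdeg size_msetn cardfs0 addn0.
Qed.

Lemma powersum_oddhomog z n : oddhomog 0 (powersum F z n).
Proof.
apply: homogeneous_infsum => i; rewrite cvarX; exact: homogeneous_smono.
Qed.

Lemma tpowersum_homogeneous z n : homogeneous deg n.+1 (tpowersum F z n).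
Proof.
apply: homogeneous_infsum => i; rewrite avar_cvarX; apply: homogeneous_smono.
by rewrite /smdeg size_msetn cardfs1 addn1.
Qed.

Lemma tpowersum_oddhomog z n : oddhomog 1 (tpowersum F z n).
Proof.
apply: homogeneous_infsum => i; rewrite avar_cvarX; apply: homogeneous_smono.
by rewrite /odddeg cardfs1.
Qed.

Definition ppair n : BS := powersum F false n * powersum F true n.
Definition tppair n : BS := tpowersum F false n * tpowersum F true n.

Lemma ppair_oddhomog n : oddhomog 0 (ppair n).
Proof.
exact (homogeneousM (@odddeg_diff _ _ _)
  (@powersum_oddhomog _ _) (@powersum_oddhomog _ _)).
Qed.

Lemma tppair_oddhomog n : oddhomog 2 (tppair n).
Proof.
exact (homogeneousM (@odddeg_diff _ _ _)
  (@tpowersum_oddhomog _ _) (@tpowersum_oddhomog _ _)).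
Qed.

Lemma ppair_homogeneous n : homogeneous deg (2 * n)%N (ppair n).
Proof.
rewrite mul2n -addnn.
exact (homogeneousM (@smdeg_diff _ _ _)
  (@powersum_homogeneous _ _) (@powersum_homogeneous _ _)).
Qed.

Lemma tppair_homogeneous n : homogeneous deg (2 * n.+1)%N (tppair n).
Proof.
rewrite mul2n -addnn.
exact (homogeneousM (@smdeg_diff _ _ _)
  (@tpowersum_homogeneous _ _) (@tpowersum_homogeneous _ _)).
Qed.

Lemma ppair_comm i n (f : BS) : oddhomog i f -> GRing.comm (ppair n) f.
Proof. exact/oddhomog0_comm/ppair_oddhomog. Qed.

Lemma tppair_comm i n (f : BS) : oddhomog i f -> GRing.comm (tppair n) f.
Proof. by apply/oddhomog_even_comm/tppair_oddhomog; rewrite oddM. Qed.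

Lemma oddhomog_tpowersums z (s : seq nat) :
  oddhomog (size s) (\prod_(k <- s) tpowersum F z k).
Proof.
rewrite -sum1_size.
exact (homogeneous_prod (@odddeg_diff _ _ _) (@tpowersum_oddhomog z)).
Qed.

Lemma oddhomog_powersums z (s : seq nat) :
  oddhomog 0 (\prod_(k <- s) powersum F z k).
Proof.
rewrite [X in oddhomog X _](_ : 0 = \sum_(k <- s) 0)%N; last by rewrite big1.
exact (homogeneous_prod (@odddeg_diff _ _ _) (@powersum_oddhomog z)).
Qed.

(** Each new factor in the second alphabet crosses [size s] odd factors of the first one; by
    Pascal's rule these signs accumulate to the binomial exponent. *)
Lemma prod_tppair (s : seq nat) : \prod_(k <- s) tppair k =
  (-1) ^+ 'C(size s, 2) *:
    (\prod_(k <- s) tpowersum F false k * \prod_(k <- s) tpowersum F true k).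
Proof.
elim: s => [|k s IHs]; first by rewrite !big_nil scale1r mulr1.
rewrite !big_cons IHs /tppair -scalerAr -[LHS]scale1r /= binS bin1 exprD.
set p := tpowersum F false k; set q := tpowersum F true k.
set P := \prod_(j <- s) _; set Q := \prod_(j <- s) _.
have -> : p * P * (q * Q) = (-1) ^+ size s *: (p * q * (P * Q)).
  rewrite -!mulrA [P * (q * Q)]mulrA.
  rewrite (oddhomogC (@oddhomog_tpowersums _ _) (@tpowersum_oddhomog _ _)) muln1.
  by rewrite -scalerAl -scalerAr -mulrA.
by rewrite !scalerA -mulrA -expr2 sqrr_sign mulr1 mul1r.
Qed.

Lemma prod_ppair (s : seq nat) : \prod_(k <- s) ppair k =
  \prod_(k <- s) powersum F false k * \prod_(k <- s) powersum F true k.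
Proof.
elim: s => [|k s IHs]; first by rewrite !big_nil mulr1.
rewrite !big_cons IHs /ppair -!mulrA; congr (_ * _); rewrite !mulrA; congr (_ * _).
exact: oddhomog0_comm (@powersum_oddhomog _ _) (@oddhomog_powersums _ _).
Qed.

Definition kterm L : BS := (zfactor L)%:R^-1 *:
  (ssreverse (superpowersum F false L) * superpowersum F true L).

(** The sign of the reversal is exactly the one in [prod_tppair], so the term is a product of
    commuting pairs without sign. *)
Lemma ktermE L : kterm L = (zfactor L)%:R^-1 *:
  (\prod_(k <- sp_a L) tppair k * \prod_(k <- sp_s L) ppair k).
Proof.
rewrite /kterm prod_tppair prod_ppair.
rewrite (@ssreverse_oddhomog _ _ _ _ (size (sp_a L))); last first.
  rewrite -[size _]addn0.
  exact (homogeneousM (@odddeg_diff _ _ _)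
    (@oddhomog_tpowersums _ _) (@oddhomog_powersums _ _)).
rewrite -!scalerAl; congr (_ *: (_ *: _)); rewrite /superpowersum -!mulrA.
congr (_ * _); rewrite !mulrA; congr (_ * _).
exact: oddhomog0_comm (@oddhomog_powersums _ _) (@oddhomog_tpowersums _ _).
Qed.

Lemma kterm_homogeneous L : homogeneous deg (2 * spdeg L)%N (kterm L).
Proof.
rewrite ktermE; apply: homogeneousZ; rewrite mulnDr !big_distrr /=.
exact (homogeneousM (@smdeg_diff _ _ _)
  (homogeneous_prod (@smdeg_diff _ _ _) tppair_homogeneous)
  (homogeneous_prod (@smdeg_diff _ _ _) ppair_homogeneous)).
Qed.

Lemma prod_ppair_comm k (s : seq nat) :
  GRing.comm (\prod_(j <- s) ppair j) (tppair k).
Proof.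
apply/commr_sym/commr_prod => j _; apply: tppair_comm; exact: ppair_oddhomog.
Qed.

Section Characteristic0.
Hypothesis charF0 : [pchar F] =i pred0.

Lemma kterm_rem_s k L : (0 < k)%N -> k \in sp_s L ->
  kterm (sp_rem_s k L) * ppair k = (k * count_mem k (sp_s L))%:R *: kterm L.
Proof.
move=> k0 ks; rewrite !ktermE scalerA (zfactor_rem ks) (natrM _ (k * _)) invfM
  [_%:R * _]mulrA.
rewrite divff ?mul1r; last first.
  move/pcharf0P: charF0 => ->; rewrite muln_eq0 negb_or -!lt0n k0 /=.
  by rewrite -has_count has_pred1.
rewrite -scalerAl -mulrA; congr (_ *: (_ * _)).
rewrite [RHS](@prod_rem_comm _ _ _ k) // => i j.
by apply: ppair_comm; apply: ppair_oddhomog.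
Qed.

Lemma kterm_rem_a k L : k \in sp_a L ->
  kterm (sp_rem_a k L) * tppair k = kterm L.
Proof.
move=> ka; rewrite !ktermE -scalerAl -mulrA prod_ppair_comm mulrA.
congr (_ *: (_ * _)).
rewrite [RHS](@prod_rem_comm _ _ _ k) // => i j.
by apply: tppair_comm; apply: tppair_oddhomog.
Qed.

(** The sign rule makes the square its own opposite, and 2 is invertible. *)
Lemma tpowersum_sq z k : tpowersum F z k * tpowersum F z k = 0.
Proof.
have h := @tpowersum_oddhomog z k; have := oddhomogC h h.
rewrite expr1 scaleN1r => /eqP; rewrite -addr_eq0 => /eqP E.
apply/funext => m; move/(congr1 (fun f : BS => f m)): E; rewrite ssD ss0 => /eqP.
rewrite -mulr2n -mulr_natr mulf_eq0 => /orP[/eqP //|].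
by move/pcharf0P: charF0 => ->.
Qed.

Lemma tppair_sq k : tppair k * tppair k = 0.
Proof.
have h z := @tpowersum_oddhomog z k.
rewrite /tppair mulrA (oddhomogC (homogeneousM (@odddeg_diff _ _ _) (h _) (h _)) (h _)).
by rewrite mulrA tpowersum_sq mul0r scaler0 mul0r.
Qed.

Lemma kterm_mem_a k L : k \in sp_a L -> kterm L * tppair k = 0.
Proof. by move=> ka; rewrite -(kterm_rem_a ka) -mulrA tppair_sq mulr0. Qed.

Definition ksum N : BS := \sum_(L <- sp_set N) kterm L.

(* Half of the Euler logarithmic derivative of the kernel, up to degree N in (x, theta). *)
Definition klog N : BS := \sum_(k < N) (ppair k.+1 + k.+1%:R *: tppair k).

Lemma eqm0_homogeneous (m : smonom (bool * nat)%type (bool *l nat)%type) n (f : BS) :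
  homogeneous deg n f -> (smdeg m < n)%N -> eqm m f 0.
Proof.
move=> hf mn a /smdeg_diff am; rewrite hf //; apply: contraTneq mn => <-.
by rewrite -leqNgt am leq_addr.
Qed.

Section Congruence.
Context (m : smonom (bool * nat)%type (bool *l nat)%type) (N : nat).
Hypothesis mN : (smdeg m <= N)%N.

Lemma eqm_kterm0 L n (f : BS) : (N < spdeg L + n)%N ->
  homogeneous deg (2 * n)%N f -> eqm m (kterm L * f) 0.
Proof.
move=> LN hf; apply: eqm0_homogeneous.
  exact (homogeneousM (@smdeg_diff _ _ _) (@kterm_homogeneous L) hf).
apply: leq_ltn_trans mN _; rewrite -mulnDr; apply: leq_trans LN _.
by rewrite mul2n -addnn leq_addr.
Qed.

(** Multiplication adds a part [k.+1], and the coefficient compensates the change of [zfactor]. The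
    products that would leave [sp_set N] have degree above that of [m], hence vanish in the
    congruence. *)
Lemma ksum_ppair k : eqm m (ksum N * ppair k.+1)
  (\sum_(L <- sp_set N) (k.+1 * count_mem k.+1 (sp_s L))%:R *: kterm L).
Proof.
rewrite [X in eqm m _ X](bigID (fun L => k.+1 \in sp_s L)) /=.
rewrite [X in _ + X]big1 ?addr0; last first.
  by move=> L /count_memPn ->; rewrite muln0 scale0r.
under eq_bigr => L ks do rewrite -kterm_rem_s //.
rewrite (big_sp_rem_s N k (fun L => kterm L * ppair k.+1)) big_mkcond mulr_suml.
apply: eqm_sum => L _; case: leqP => // LN.
exact/(eqm_kterm0 LN)/ppair_homogeneous.
Qed.

(** As for [ppair], except that the terms already containing [k] in [sp_a] are killed because
    [tppair k] squares to 0. *)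
Lemma ksum_tppair k : eqm m (ksum N * tppair k)
  (\sum_(L <- sp_set N) (k \in sp_a L)%:R *: kterm L).
Proof.
rewrite [X in eqm m _ X](bigID (fun L => k \in sp_a L)) /=.
rewrite [X in _ + X]big1 ?addr0; last first.
  by move=> L /negPf ->; rewrite scale0r.
under eq_bigr => L ka do rewrite ka scale1r -(kterm_rem_a ka).
rewrite (big_sp_rem_a N k (fun L => kterm L * tppair k)) big_mkcond mulr_suml.
apply: eqm_sum => L _; case: (boolP (k \in sp_a L)) => [ka|_] /=.
  by rewrite kterm_mem_a.
case: leqP => // LN; exact/(eqm_kterm0 LN)/tppair_homogeneous.
Qed.

(** Each [kterm L] is an eigenvector with eigenvalue [2 spdeg L]. Splitting [spdeg L] by part values
    and exchanging sums yields the products computed in the two preceding lemmas. *)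
Lemma euler_ksum : eqm m (euler (ksum N)) (ksum N * (2%:R *: klog N)).
Proof.
have -> : euler (ksum N) = 2%:R *: \sum_(k < N)
   (\sum_(L <- sp_set N) (k.+1 * count_mem k.+1 (sp_s L))%:R *: kterm L
    + k.+1%:R *: \sum_(L <- sp_set N) ((k : nat) \in sp_a L)%:R *: kterm L).
  rewrite /ksum euler_sum big_split /= exchange_big /=.
  under [X in _ + X]eq_bigr do rewrite scaler_sumr.
  rewrite [X in _ + X]exchange_big -big_split scaler_sumr /=.
  rewrite big_seq [RHS]big_seq; apply: eq_bigr => L; rewrite in_sp_set => LN.
  rewrite (euler_homogeneous (@kterm_homogeneous L)) natrM -scalerA; congr (_ *: _).
  rewrite {1}(spdeg_count LN) addnC natrD scalerDl !natr_sum !scaler_suml.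
  congr (_ + _).
  by apply: eq_bigr => k _; rewrite natrM scalerA.
rewrite -scalerAr mulr_sumr; apply/eqmZ/eqm_sum => k _; rewrite mulrDr -scalerAr.
by apply/eqm_sym/eqmD; [exact: ksum_ppair|apply/eqmZ/ksum_tppair].
Qed.

End Congruence.

Lemma ksum_one N : ksum N (smone _ _) = 1.
Proof.
have L0P : is_superpartition ([::], [::]) by [].
rewrite /ksum ss_sum (bigD1_seq (Superpartition L0P)) ?fset_uniq //=; last first.
  by rewrite in_sp_set /spdeg !big_nil.
rewrite ktermE /zfactor /= !big_nil invr1 scale1r mulr1 ssE1 eqxx big1 ?addr0 //.
move=> L L0; apply: kterm_homogeneous; rewrite smdeg_one eq_sym muln_eq0 /=.
apply: contra L0; rewrite addn_eq0 => /andP[a0 s0]; apply/eqP/sp_inj => /=.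
  by case: (sp_a L) a0 => // k s; rewrite big_cons.
case: (sp_s L) s0 (sp_s_neq0 L) => // k s; rewrite big_cons addn_eq0 => /andP[/eqP->].
by rewrite mem_head.
Qed.

Lemma has_sum_kterm (S : BS) : (forall m, S m = ksum (smdeg m) m) ->
  has_sum kterm S.
Proof.
(* A superpartition outside this set has a term of degree [2 spdeg L], larger than that of [m]. *)
move=> SE m; exists (sp_set (smdeg m)) => A sub; rewrite SE.
apply: (eqm_sum_fsubset sub) (smlexx m) => L; rewrite in_sp_set -ltnNge => mL.
apply: eqm0_homogeneous (@kterm_homogeneous L) _; apply: leq_trans mL _.
by rewrite mul2n -addnn leq_addr.
Qed.

End Characteristic0.
End PowerSumTerms.

(** * The kernel factors and the Euler equation of their finite products *)

Lemma exprDn_sq0 (R : nzRingType) (a b : R) k : GRing.comm a b -> b * b = 0 ->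
  (a + b) ^+ k.+1 = a ^+ k.+1 + b * a ^+ k *+ k.+1.
Proof.
move=> ab bb; elim: k => [|k IHk]; first by rewrite !expr1 expr0 mulr1.
rewrite exprS {}IHk mulrDl !mulrDr -exprS !mulrnAr [b * (b * _)]mulrA bb.
rewrite mul0r mul0rn addr0 mulrA ab -mulrA -exprS -addrA; congr (_ + _).
by rewrite -mulrSr.
Qed.

Section KernelExpansion.
Context (F : fieldType).
Notation BS := (bisuperseries F).
Notation smon := (smonom (bool * nat)%type (bool *l nat)%type).
Notation deg := (@smdeg (bool * nat)%type _ (bool *l nat)%type).
Notation x i := (cvar F false i).
Notation y j := (cvar F true j).
Notation t i := (avar F false i).
Notation p j := (avar F true j).
Implicit Types (ij : nat * nat) (m : smon).

Lemma cvar_oddhomog z i : oddhomog 0 (cvar F z i).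
Proof. exact: homogeneous_smono. Qed.

Lemma avar_oddhomog z i : oddhomog 1 (avar F z i).
Proof. by apply: homogeneous_smono; rewrite /odddeg cardfs1. Qed.

Lemma cvar_comm n z i (f : BS) : oddhomog n f -> GRing.comm (cvar F z i) f.
Proof. exact/oddhomog0_comm/cvar_oddhomog. Qed.

Lemma cvar_homogeneous z i : homogeneous deg 1 (cvar F z i).
Proof. by apply: homogeneous_smono; rewrite /smdeg size_msetn. Qed.

Lemma avar_homogeneous z i : homogeneous deg 1 (avar F z i).
Proof. by apply: homogeneous_smono; rewrite /smdeg size_mset0 cardfs1. Qed.

Definition kw ij : BS := x ij.1 * y ij.2 + t ij.1 * p ij.2.

Lemma kernel_factorE ij : kernel_factor F ij = (1 - kw ij)^-1.
Proof. by rewrite /kernel_factor /kw opprD addrA. Qed.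

Lemma unitr_1Bkw ij : 1 - kw ij \is a GRing.unit.
Proof. by case: ij => i j; rewrite /kw opprD addrA kernel_factor_unit. Qed.

Lemma kw_comm n ij (f : BS) : oddhomog n f -> GRing.comm (kw ij) f.
Proof.
move=> hf; apply/commr_sym/commrD.
  by apply: commrM; apply/commr_sym/cvar_comm/hf.
apply/commr_sym; apply: oddhomog_even_comm hf; last first.
  exact (homogeneousM (@odddeg_diff _ _ _) (@avar_oddhomog _ _) (@avar_oddhomog _ _)).
by rewrite oddM.
Qed.

Lemma kw_kw_comm ij kl : GRing.comm (kw ij) (kw kl).
Proof.
apply: commrD; apply: kw_comm.
  exact (homogeneousM (@odddeg_diff _ _ _) (@cvar_oddhomog _ _) (@cvar_oddhomog _ _)).
exact (homogeneousM (@odddeg_diff _ _ _) (@avar_oddhomog _ _) (@avar_oddhomog _ _)).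
Qed.

Lemma kw_kernel_factor_comm ij kl : GRing.comm (kw ij) (kernel_factor F kl).
Proof.
rewrite kernel_factorE; apply: commrV; apply: commrB; first exact: commr1.
exact: kw_kw_comm.
Qed.

Lemma kernel_factor_comm ij kl :
  GRing.comm (kernel_factor F ij) (kernel_factor F kl).
Proof.
rewrite (kernel_factorE kl); apply: commrV; apply: commrB; first exact: commr1.
exact/commr_sym/kw_kernel_factor_comm.
Qed.

Lemma kernel_factor_rec ij :
  kernel_factor F ij = 1 + kw ij * kernel_factor F ij.
Proof.
rewrite kernel_factorE -[X in X = _]mul1r -{1}(subrK (kw ij) 1) mulrDl.
by rewrite divrr ?unitr_1Bkw.
Qed.

(** A geometric expansion with exact remainder. The remainder is a multiple of [kw ij ^+ n.+1], so
    it is invisible in degrees at most [n]. *)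
Lemma kw_kernel_factor ij n : kw ij * kernel_factor F ij =
  \sum_(k < n) kw ij ^+ k.+1 + kw ij ^+ n * (kw ij * kernel_factor F ij).
Proof.
elim: n => [|n IHn]; first by rewrite big_ord0 add0r mul1r.
rewrite {1}IHn big_ord_recr -addrA; congr (_ + _).
by rewrite {1}kernel_factor_rec mulrDr mulr1 mulrDr -exprSr !mulrA -exprSr.
Qed.

Lemma euler_kw ij : euler (kw ij) = 2%:R *: kw ij.
Proof.
rewrite eulerD scalerDr; congr (_ + _); apply: euler_homogeneous.
  exact (homogeneousM (@smdeg_diff _ _ _)
    (@cvar_homogeneous _ _) (@cvar_homogeneous _ _)).
exact (homogeneousM (@smdeg_diff _ _ _)
  (@avar_homogeneous _ _) (@avar_homogeneous _ _)).
Qed.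

Lemma kw_one ij : kw ij (smone _ _) = 0.
Proof.
rewrite /kw ssD.
have -> : (x ij.1 * y ij.2) (smone _ _) = 0.
  apply: (homogeneousM (@smdeg_diff _ _ _)
    (@cvar_homogeneous _ _) (@cvar_homogeneous _ _)).
  by rewrite smdeg_one.
have -> : (t ij.1 * p ij.2) (smone _ _) = 0.
  apply: (homogeneousM (@smdeg_diff _ _ _)
    (@avar_homogeneous _ _) (@avar_homogeneous _ _)).
  by rewrite smdeg_one.
by rewrite addr0.
Qed.

(** Applying the derivation to [K = 1 + w K] gives [(1 - w) D K = 2 w K], and [K] inverts
    [1 - w]. *)
Lemma euler_kernel_factor ij : euler (kernel_factor F ij) =
  kernel_factor F ij * (2%:R *: (kw ij * kernel_factor F ij)).
Proof.
set K := kernel_factor F ij.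
have KV : K * (1 - kw ij) = 1 by rewrite /K kernel_factorE mulVr ?unitr_1Bkw.
have VK : (1 - kw ij) * K = 1 by rewrite /K kernel_factorE mulrV ?unitr_1Bkw.
have := congr1 (@euler F _ _ _) (kernel_factor_rec ij); rewrite -/K.
rewrite eulerD euler1 add0r eulerM euler_kw => E.
have {}E : (1 - kw ij) * euler K = 2%:R *: (kw ij * K).
  by rewrite mulrBl mul1r {1}E addrK scalerAl.
by rewrite -E mulrA KV mul1r.
Qed.

Lemma euler_kernel_prod (s : seq (nat * nat)) :
  euler (\prod_(ij <- s) kernel_factor F ij) =
  \prod_(ij <- s) kernel_factor F ij *
  (2%:R *: \sum_(ij <- s) kw ij * kernel_factor F ij).
Proof.
elim: s => [|ij s IHs]; first by rewrite !big_nil euler1 scaler0 mulr0.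
rewrite !big_cons eulerM euler_kernel_factor IHs scalerDr mulrDr mulrA.
congr (_ + _); rewrite -!mulrA; congr (_ * _).
rewrite -scalerAl -scalerAr; congr (_ *: _).
apply/commr_sym/commrM; apply/commr_sym/commr_prod => kl _.
  exact: kw_kernel_factor_comm.
exact: kernel_factor_comm.
Qed.

Lemma kw_exp ij k : kw ij ^+ k.+1 =
  x ij.1 ^+ k.+1 * y ij.2 ^+ k.+1 +
  k.+1%:R *: (t ij.1 * x ij.1 ^+ k * (p ij.2 * y ij.2 ^+ k)).
Proof.
have xyC : GRing.comm (x ij.1) (y ij.2) by apply: cvar_comm; apply: cvar_oddhomog.
rewrite /kw exprDn_sq0.
- rewrite scaler_nat !exprMn_comm //; congr (_ + _ *+ _).
  rewrite -!mulrA; congr (_ * _); rewrite !mulrA; congr (_ * _).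
  by apply: commrX; apply: commr_sym; apply: cvar_comm; apply: avar_oddhomog.
- apply: commr_sym; apply: commrM; apply: commr_sym.
    by apply: commrM; apply: cvar_comm; apply: avar_oddhomog.
  by apply: commrM; apply: cvar_comm; apply: avar_oddhomog.
(* The square of [theta phi] becomes, up to sign, [theta theta phi phi], which is 0. *)
have pt : p ij.2 * t ij.1 = - (t ij.1 * p ij.2) by exact: oddvarC.
have tt : t ij.1 * t ij.1 = 0 by exact: oddvar_sq.
by rewrite -mulrA [p _ * _]mulrA pt mulNr mulrN !mulrA tt !mul0r oppr0.
Qed.

(** The alphabet tags are dropped, so that one finite index set serves for all four families of
    variables. *)
Definition variables m : {fset nat} :=
  ([fset v.2 | v in (m.1 : seq (bool * nat))]
    `|` [fset v.2 | v in (m.2 : seq (bool *l nat)%type)])%fset.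

Definition variable_pairs m : {fset nat * nat} :=
  [fset ij in [seq (i, j) | i <- variables m, j <- variables m]]%fset.

Lemma eqm_cvar0 m z i : i \notin variables m -> eqm m (cvar F z i) 0.
Proof.
move=> im a /smleP[/msubsetP am _]; rewrite /cvar /evenvar smonoE ss0.
case: eqP => // Ea; case/negP: im; rewrite inE; apply/orP; left.
apply/imfsetP; exists (z, i) => //=; rewrite in_mset.
by apply: leq_trans (am _); rewrite Ea /= msetnxx.
Qed.

Lemma eqm_avar0 m z i : i \notin variables m -> eqm m (avar F z i) 0.
Proof.
move=> im a /smleP[_ /fsubsetP am]; rewrite /avar /oddvar smonoE ss0.
case: eqP => // Ea; case/negP: im; rewrite inE; apply/orP; right.
apply/imfsetP; exists (z, i) => //=; apply: am.
by rewrite Ea /= inE.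
Qed.

Section Congruence.
Context (m : smon).
Let A := variables m.
Let A2 := variable_pairs m.

Lemma eqm_powersum z k :
  eqm m (powersum F z k.+1) (\sum_(i <- A) cvar F z i ^+ k.+1).
Proof.
apply: eqm_infsum; first exact: powersum_summable.
move=> i iA; rewrite exprS -[X in eqm _ _ X](mul0r (cvar F z i ^+ k)).
by apply: eqmM => //; apply: eqm_cvar0.
Qed.

Lemma eqm_tpowersum z k :
  eqm m (tpowersum F z k) (\sum_(i <- A) avar F z i * cvar F z i ^+ k).
Proof.
apply: eqm_infsum; first exact: tpowersum_summable.
move=> i iA; rewrite -[X in eqm _ _ X](mul0r (cvar F z i ^+ k)).
by apply: eqmM => //; apply: eqm_avar0.
Qed.

Lemma eqm_kw0 ij : ij \notin A2 -> eqm m (kw ij) 0.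
Proof.
move=> ijA; have : (ij.1 \notin A) || (ij.2 \notin A).
  rewrite -negb_and; apply: contra ijA => /andP[iA jA]; rewrite inE.
  by case: ij iA jA => i j /= iA jA; apply: (allpairs_f (fun i j => (i, j))).
rewrite -[X in eqm _ _ X]addr0 => /orP[iA|jA].
  rewrite -[X in eqm _ _ (X + _)](mul0r (y ij.2))
    -[X in eqm _ _ (_ + X)](mul0r (p ij.2)).
  by apply: eqmD; apply: eqmM => //; [apply: eqm_cvar0|apply: eqm_avar0].
rewrite -[X in eqm _ _ (X + _)](mulr0 (x ij.1)) -[X in eqm _ _ (_ + X)](mulr0 (t ij.1)).
by apply: eqmD; apply: eqmM => //; [apply: eqm_cvar0|apply: eqm_avar0].
Qed.

Lemma big_variables2 (u v : nat -> BS) :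
  \sum_(ij <- A2) u ij.1 * v ij.2 = (\sum_(i <- A) u i) * (\sum_(j <- A) v j).
Proof.
rewrite mulr_suml; under [RHS]eq_bigr do rewrite mulr_sumr.
transitivity (\sum_(ij <- [seq (i, j) | i <- A, j <- A]) u ij.1 * v ij.2);
  last by rewrite big_allpairs.
apply: perm_big; apply: uniq_perm; rewrite ?fset_uniq //.
  by apply: allpairs_uniq; rewrite ?fset_uniq // => -[? ?] [? ?] _ _ /= [-> ->].
by move=> ij; rewrite inE.
Qed.

(** Modulo [m], only pairs of indices occurring in [m] and powers of [kw] up to [N] survive. By
    [kw_exp] each remaining double sum factors into a power sum in each alphabet. *)
Lemma eqm_sum_kw_kernel_factor (B : {fset nat * nat}) N :
    (A2 `<=` B)%fset -> (smdeg m <= N)%N ->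
  eqm m (\sum_(ij <- B) kw ij * kernel_factor F ij) (klog F N).
Proof.
move=> AB mN.
apply: (@eqm_trans _ _ _ _ m _ (\sum_(ij <- A2) kw ij * kernel_factor F ij)).
  apply: eqm_sum_fsubset => // ij ijA.
  rewrite -[X in eqm _ _ X](mul0r (kernel_factor F ij)); apply: eqmM => //.
  exact: eqm_kw0.
apply: (@eqm_trans _ _ _ _ m _ (\sum_(ij <- A2) \sum_(k < N) kw ij ^+ k.+1)).
  apply: eqm_sum => ij _; rewrite (kw_kernel_factor ij N).
  rewrite -[X in eqm _ _ X]addr0; apply: eqmD => //.
  rewrite mulrA -exprSr -[X in eqm _ _ X](mul0r (kernel_factor F ij)).
  apply: eqmM => // a /smdeg_diff am; rewrite ssexp_deg ?kw_one // ltnS.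
  by apply: leq_trans mN; rewrite am leq_addr.
rewrite exchange_big; apply: eqm_sum => k _.
under eq_bigr do rewrite kw_exp.
rewrite big_split -scaler_sumr /=.
rewrite (big_variables2 (fun i => x i ^+ k.+1) (fun j => y j ^+ k.+1)).
rewrite (big_variables2 (fun i => t i * x i ^+ k) (fun j => p j * y j ^+ k)).
apply/eqm_sym/eqmD; first by apply: eqmM; apply: eqm_powersum.
by apply: eqmZ; apply: eqmM; apply: eqm_tpowersum.
Qed.

End Congruence.

Lemma eqm_kw_one ij : eqm (smone _ _) (kw ij * kernel_factor F ij) 0.
Proof.
rewrite -[X in eqm _ _ X](mul0r (kernel_factor F ij)); apply: eqmM => // a.
by move=> /smle_one ->; rewrite kw_one.
Qed.

Lemma kernel_prod_one (s : seq (nat * nat)) :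
  (\prod_(ij <- s) kernel_factor F ij) (smone _ _) = 1.
Proof.
suff E : eqm (smone _ _) (\prod_(ij <- s) kernel_factor F ij) 1.
  by rewrite E ?smlexx // ssE1 eqxx.
elim: s => [|ij s IHs]; first by rewrite big_nil.
rewrite big_cons -[X in eqm _ _ X]mulr1; apply: eqmM => //.
rewrite kernel_factor_rec -[X in eqm _ _ X]addr0; apply: eqmD => //.
exact: eqm_kw_one.
Qed.

(** For [B] containing [variable_pairs m], the finite product and [ksum] have constant term 1 and
    satisfy the same Euler equation modulo [m], so uniqueness identifies their coefficients at
    [m]. *)
Lemma has_prod_kernel_factor (charF0 : [pchar F] =i pred0) (S : BS) :
  (forall m, S m = ksum F (smdeg m) m) -> has_prod (@kernel_factor F) S.
Proof.
move=> SE m; exists (variable_pairs m) => B AB; rewrite SE.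
pose g : BS := 2%:R *: \sum_(ij <- B) kw ij * kernel_factor F ij.
have g1 : g (smone _ _) = 0.
  rewrite /g ssZ ss_sum big1 ?mulr0 // => ij _.
  by rewrite eqm_kw_one ?smlexx.
have f1 : (\prod_(ij <- B) kernel_factor F ij) (smone _ _)
    = ksum F (smdeg m) (smone _ _) by rewrite kernel_prod_one ksum_one.
apply: (euler_solution_unique charF0 f1 g1 _ _ _ (smlexx m)).
- by rewrite euler_kernel_prod; apply: eqm_refl.
- exact: euler_ksum.
- by apply: eqmZ; apply: eqm_sum_kw_kernel_factor AB _.
Qed.

End KernelExpansion.

Theorem theorem29 (F : fieldType) (charF0 : [pchar F] =i pred0) :
  let term (L : superpartition) : bisuperseries F :=
    (zfactor L)%:R^-1 *:
      (ssreverse (superpowersum F false L) * superpowersum F true L) in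
  [/\ multipliable (@kernel_factor F),
      summable term
    & kernel F = infsum term].
Proof.
(* The common limit: each coefficient is read off the truncation at the degree of its own
   monomial. *)
move=> term; pose S : bisuperseries F := fun m => ksum F (smdeg m) m.
have Sprod : has_prod (@kernel_factor F) S by apply: has_prod_kernel_factor.
have Ssum : has_sum term S by apply: has_sum_kterm.
split; [by exists S|by exists S|].
by rewrite /kernel (infprodE Sprod) (infsumE Ssum).
Qed.
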